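(* Let $\mathcal T$ be a péijí topology on $\mathbb Z$ with maximal family $\{\mathcal T_n\}_{n\in\mathbb N_1}$, and assume that $\mathcal T$ has a determining monoid $\mathcal M\subseteq\mathbb N_1$ such that $\pi_n^m(B_m)=B_n$ for all $n,m\in\mathcal M$ with $n$ dividing $m$. Let $$B:=\bigcap_{n\in\mathcal M}\hat\pi_n^{-1}(B_n)\subseteq\hat{\mathbb Z}\,.$$ Then every $x\in B$ is an indiscrete point of $(\hat{\mathbb Z},\mathcal T)$, that is, the only open subset of $(\hat{\mathbb Z},\mathcal T)$ containing $x$ is $\hat{\mathbb Z}$ itself.
   Context: Notation: $\mathbb N_1$ is the set of positive integers; $\pi_n\colon\mathbb Z\to\mathbb Z/n\mathbb Z$ is reduction modulo $n$; if $n\mid m$, $\pi_n^m\colon\mathbb Z/m\mathbb Z\to\mathbb Z/n\mathbb Z$ is the natural projection. $\hat{\mathbb Z}=\varprojlim_n\mathbb Z/n\mathbb Z$, seen as the subset of compatible sequences in $\prod_{n\in\mathbb N_1}\mathbb Z/n\mathbb Z$, and $\hat\pi_n\colon\hat{\mathbb Z}\to\mathbb Z/n\mathbb Z$ is the $n$-th projection. Péijí topologies: a family $\{\mathcal T_n\}_{n\in\mathbb N_1}$ of topologies, $\mathcal T_n$ on $\mathbb Z/n\mathbb Z$, induces the coarsest topology $\mathcal T$ on $\mathbb Z$ such that all maps $\pi_n\colon(\mathbb Z,\mathcal T)\to(\mathbb Z/n\mathbb Z,\mathcal T_n)$ are continuous. A péijí topology is a topology on $\mathbb Z$ obtained in this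 way. Two families are equivalent if they induce the same topology on $\mathbb Z$; a family is maximal if each $\mathcal T_n$ is the finest possible among all families in its equivalence class. The maximal family of $\mathcal T$ consists of the quotient topologies: $A\subseteq\mathbb Z/n\mathbb Z$ is in $\mathcal T_n$ iff $\pi_n^{-1}(A)\in\mathcal T$. Determining monoid: a multiplicative submonoid $\mathcal M\subseteq\mathbb N_1$ such that the maximal family $\{\mathcal T_n\}$ of $\mathcal T$ is equivalent to the family $\{\mathcal T'_n\}$ with $\mathcal T_n'=\mathcal T_n$ for $n\in\mathcal M$ and $\mathcal T_n'$ the trivial topology otherwise. $B_n$ denotes the intersection of all nonempty closed subsets of $(\mathbb Z/n\mathbb Z,\mathcal T_n)$, with $\{\mathcal T_n\}$ the maximal family. $(\hat{\mathbb Z},\mathcal T)$ denotes $\hat{\mathbb Z}$ with the subspace topology from the product space $\prod_{n\in\mathbb N_1}(\mathbb Z/n\mathbb Z,\mathcal T_n)$, with $\{\mathcal T_n\}$ the maximal family. *)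

(* Defs.v *)
From HB Require Import structures.
From mathcomp Require Import all_boot all_order all_algebra.
From mathcomp Require Import all_classical all_reals all_analysis.
Set Implicit Arguments.
Unset Strict Implicit.
Unset Printing Implicit Defensive.
Import Order.TTheory GRing.Theory Num.Theory.
Local Open Scope classical_set_scope.
Local Open Scope ring_scope.

(* Several topologies on one carrier are compared below, so a topology is a
   value here; [topspace tau] is the carrier as a library topological space
   with the topology [tau], and [open], [closed], [continuous] on it are the
   library's. *)
Record topology (T : choiceType) := Topology {
  opens :> set_system T ;
  opensT : opens setT ;
  opensI : setI_closed opens ;
  opens_bigU : forall (I : Type) (f : I -> set T),
    (forall i, opens (f i)) -> opens (\bigcup_i f i) }.

Definition topspace (T : choiceType) (tau : topology T) : Type := T.

HB.instance Definition _ (T : choiceType) (tau : topology T) :=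
  Choice.on (topspace tau).
HB.instance Definition _ (T : choiceType) (tau : topology T) :=
  isOpenTopological.Build (topspace tau)
    (opensT tau) (@opensI T tau) (@opens_bigU T tau).

Lemma topspace_openE (T : choiceType) (tau : topology T) :
  @open (topspace tau) = opens tau.
Proof.
apply/funext => U; apply/propext; split => [|oU]; last first.
  by rewrite openE => x Ux; exists U; split.
rewrite openE => Uo.
have -> : U = \bigcup_(V : {V : set T | opens tau V /\ V `<=` U}) sval V.
  apply/seteqP; split => [x Ux|x [[V [? VU]] _ /= Vx]]; last exact: VU.
  have [V [oV Vx VU]] := Uo x Ux.
  by exists (exist _ V (conj oV VU)).
by apply: opens_bigU => -[V []].
Qed.

(* [coarser tau tau'] is non-strict. *)
Definition coarser (T : choiceType) (tau tau' : topology T) : Prop :=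
  opens tau `<=` opens tau'.

Section TrivialTopology.
Variable T : choiceType.

Let triv : set_system T := [set U | U = set0 \/ U = setT].

Let trivT : triv setT. Proof. by right. Qed.

Let trivI : setI_closed triv.
Proof.
by move=> A B [->|->] [->|->]; rewrite ?(setI0, set0I, setIT); [left|left|left|right].
Qed.

Let triv_bigU (I : Type) (f : I -> set T) :
  (forall i, triv (f i)) -> triv (\bigcup_i f i).
Proof.
move=> tf; have [[i fi]|nf] := pselect (exists i, f i = setT).
  by right; rewrite -subTset -fi; exact: bigcup_sup.
left; rewrite bigcup0 // => i _.
by have [//|fi] := tf i; case: nf; exists i.
Qed.

Definition trivial_topology : topology T := Topology trivT trivI triv_bigU.

End TrivialTopology.

Record N1 := MkN1 { N1_val :> nat ; N1_gt0 : (0 < N1_val)%N }.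

HB.instance Definition _ := [isSub for N1_val].
HB.instance Definition _ := [Countable of N1 by <:].

Definition one_N1 : N1 := @MkN1 1 isT.

Lemma mul_N1_subproof (m n : N1) : (0 < m * n)%N.
Proof. by rewrite muln_gt0 !N1_gt0. Qed.

Definition mul_N1 (m n : N1) : N1 := MkN1 (mul_N1_subproof m n).

(* Z/nZ.  The form .-1.+1 gives access to the group structure of zmodp for
   every n >= 1; 'Z_n would be Z/2Z at n = 1. *)
Definition Zmod (n : N1) := 'I_n.-1.+1.

HB.instance Definition _ (n : N1) := GRing.Zmodule.on (Zmod n).

(* pi_n : the group morphism Z -> Z/nZ sending 1 to the class of 1. *)
Definition Zred (n : N1) (z : int) : Zmod n := (inZp 1 : Zmod n) *~ z.

(* pi_n^m : Z/mZ -> Z/nZ, only meaningful when n divides m. *)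
Definition Zproj (m n : N1) (x : Zmod m) : Zmod n := inZp x.
Arguments Zproj : clear implicits.

Lemma Zred_modz (n : N1) (z : int) : (Zred n z : nat)%:Z = (z %% (n : nat)%:Z)%Z.
Proof.
have nE : (n.-1.+1 = n :> nat) by rewrite prednK // N1_gt0.
have redn (k : nat) : (Zred n k : nat) = (k %% n)%N.
  rewrite /Zred -pmulrn; elim: k => [|k IH]; first by rewrite mulr0n /= mod0n.
  by rewrite mulrS /= IH nE modnDml modnDmr add1n.
case: z => k; first by rewrite redn modz_nat.
have addE (x y : Zmod n) : ((x + y)%R : nat) = ((x + y) %% n)%N.
  exact: (congr1 (modn (x + y)) nE).
have h : (((Zred n (Negz k) : nat) + k.+1) %% n = 0)%N.
  rewrite -modnDmr -(redn k.+1) -addE.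
  by rewrite (_ : Zred n (Negz k) = - Zred n k.+1) // addNr.
set r : nat := Zred n (Negz k); have rn : (r < n)%N by rewrite -[ltnRHS]nE; exact: ltn_ord.
have {}h : ((r%:Z + k.+1%:Z) %% (n : nat)%:Z)%Z = 0.
  by rewrite -PoszD modz_nat h.
rewrite -[LHS](@modz_small r n) ?ltz_nat //.
rewrite -[Posz r](addrK k.+1%:Z) -modzDml h add0r NegzE.
by [].
Qed.

Lemma Zproj_red (m n : N1) (z : int) :
  (n %| m)%N -> Zproj m n (Zred m z) = Zred n z.
Proof.
move=> nm; apply: val_inj.
have -> : val (Zproj m n (Zred m z)) = (Zred m z %% n)%N.
  exact: (congr1 (modn (Zred m z)) (prednK (N1_gt0 n))).
suff [] : (Zred m z %% n)%N%:Z = (Zred n z : nat)%:Z by [].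
rewrite -modz_nat !Zred_modz; apply/eqP; rewrite eqz_mod_dvd.
apply: (@dvdz_trans (m : nat)%:Z); first by rewrite dvdzE.
by rewrite -eqz_mod_dvd modz_mod.
Qed.

Definition topfamily := forall n : N1, topology (Zmod n).

Definition Zred_continuous (fam : topfamily) (tau : topology int) : Prop :=
  forall n : N1, continuous (Zred n : topspace tau -> topspace (fam n)).

(* tau is the coarsest topology on Z making all the reductions continuous. *)
Definition induces (fam : topfamily) (tau : topology int) : Prop :=
  Zred_continuous fam tau /\
  forall tau', Zred_continuous fam tau' -> coarser tau tau'.

Definition peiji (tau : topology int) : Prop := exists fam, induces fam tau.

Definition equivalent (fam fam' : topfamily) : Prop :=
  exists tau, induces fam tau /\ induces fam' tau.

Definition maximal_topfamily (fam : topfamily) : Prop :=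
  forall fam', equivalent fam fam' -> forall n, coarser (fam' n) (fam n).

Definition maximal_family_of (tau : topology int) (fam : topfamily) : Prop :=
  induces fam tau /\ maximal_topfamily fam.

Definition submonoid (M : set N1) : Prop :=
  M one_N1 /\ forall m n, M m -> M n -> M (mul_N1 m n).

Definition restrict_family (M : set N1) (fam : topfamily) : topfamily :=
  fun n => if `[< M n >] then fam n else trivial_topology (Zmod n).

Definition determining_monoid (tau : topology int) (M : set N1) : Prop :=
  submonoid M /\
  forall fam, maximal_family_of tau fam ->
    equivalent fam (restrict_family M fam).

(* B_n, the intersection of all nonempty closed subsets of (Z/nZ, T_n). *)
Definition closed_core (fam : topfamily) (n : N1) : set (Zmod n) :=
  \bigcap_(C in [set C : set (topspace (fam n)) | closed C /\ C !=set0]) C.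

Arguments closed_core fam n : clear implicits.

(* The profinite integers inside the product of the (Z/nZ, T_n); as a
   [set_type] it carries the library's subspace topology. *)
Definition compatible (fam : topfamily) :
    set (prod_topology (fun n : N1 => topspace (fam n))) :=
  [set x | forall m n : N1, (n %| m)%N -> Zproj m n (x m : Zmod m) = x n].

Arguments compatible fam : clear implicits.

Definition Zhat (fam : topfamily) : topologicalType := set_type (compatible fam).

Definition hatpi (fam : topfamily) (n : N1) (x : Zhat fam) : Zmod n :=
  (set_val x : prod_topology (fun n : N1 => topspace (fam n))) n.
Arguments hatpi fam n x : clear implicits.


Definition indiscrete_point (X : topologicalType) (x : X) : Prop :=
  forall U : set X, open U -> U x -> U = setT.
Arguments indiscrete_point : clear implicits.

(* Main.v *)
Require Import Defs.
From mathcomp Require Import all_boot all_order all_algebra.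
From mathcomp Require Import ring.
From mathcomp Require Import all_classical all_reals all_analysis.
Local Open Scope classical_set_scope.

(** It suffices that every coordinate [x_n] lies in no proper open subset of
    [(Z/nZ, T_n)].  Let [U] be a member of [T_n] with [x_n] in [U], and let [W]
    be its preimage in [Z].  Since [M] is determining, [W] is a union of open
    sets that are periodic modulo elements of [M]; being also [n]-periodic, it
    is, by the Chinese remainder theorem, periodic modulo any [g] that is a
    multiple of all [gcd (n, m)] with [m] in [M].  Taking [g = gcd (n, s)] with
    [s] in [M] maximizing it, [W] is the preimage of a subset [V] of [Z/sZ],
    which is open because [T_s] is the quotient topology, and contains [x_s].
    As [x_s] is in [B_s], [V] is everything, hence so is [U]. *)

Definition periodic (m : N1) (A : set int) : Prop :=
  forall a b : int, Zred m a = Zred m b -> A a -> A b.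

Lemma Zred_eq (n : N1) (a b : int) :
  Zred n a = Zred n b <-> ((n : nat)%:Z %| (a - b)%R)%Z.
Proof.
rewrite -eqz_mod_dvd; split=> [ab|/eqP ab].
  by rewrite -!Zred_modz ab.
apply: val_inj; suff [] : Posz (Zred n a) = Posz (Zred n b) by [].
by rewrite !Zred_modz.
Qed.

Lemma Zred_dvd (m n : N1) (a b : int) : (n %| m)%N ->
  Zred m a = Zred m b -> Zred n a = Zred n b.
Proof. by move=> nm e; rewrite -!(Zproj_red _ nm) e. Qed.

Lemma Zred_surj (n : N1) (x : Zmod n) : exists a : int, Zred n a = x.
Proof.
exists (Posz x); apply: val_inj.
suff [] : Posz (Zred n (Posz x)) = Posz (val x) by [].
rewrite Zred_modz modz_nat modn_small //.
by rewrite -[ltnRHS](prednK (N1_gt0 n)).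
Qed.

Lemma chinese_gcd (m n : N1) (a b : int) :
  ((gcdn m n)%:Z %| (a - b)%R)%Z ->
  exists c : int, Zred m c = Zred m a /\ Zred n c = Zred n b.
Proof.
have [u [v uv]] := Bezoutz (m : nat)%:Z (n : nat)%:Z.
move=> /dvdzP [q]; rewrite -[Posz (gcdn m n)]/(gcdz m n) -uv => ab.
(* Bezout gives [a - b = q * (u * m + v * n)], so this witness also equals [b + q * v * n]. *)
exists (a - q * (u * (m : nat)%:Z))%R; split; apply/Zred_eq/dvdzP.
  by exists (- (q * u))%R; ring.
exists (q * v)%R; rewrite GRing.addrAC ab; ring.
Qed.

(** The values [gcdn m n] are bounded by [n], so some [s] attains the largest. For [m] in [M],
    [gcdn (s * m) n] is a multiple of [gcdn s n], hence equal to it by maximality, and [gcdn m n]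
    divides it. *)
Lemma exists_max_gcd (M : set N1) (n : N1) : submonoid M ->
  exists2 s, M s & forall m, M m -> (gcdn m n %| gcdn s n)%N.
Proof.
move=> [M1 MM].
pose P k := `[< exists2 m, M m & gcdn m n = k >].
have exP : exists k, P k by exists (gcdn one_N1 n); apply/asboolP; exists one_N1.
have ubP k : P k -> (k <= n)%N.
  by move=> /asboolP [m _ <-]; rewrite dvdn_leq ?N1_gt0 // dvdn_gcdr.
case: (ex_maxnP exP ubP) => _ /asboolP [s Ms <-] maxs; exists s => // m Mm.
have ds : (gcdn s n %| gcdn (mul_N1 s m) n)%N.
  by rewrite dvdn_gcd dvdn_gcdr (dvdn_trans (dvdn_gcdl _ _)) // dvdn_mulr.
have /eqP -> : gcdn s n == gcdn (mul_N1 s m) n.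
  rewrite eqn_leq maxs ?andbT; last first.
    by apply/asboolP; exists (mul_N1 s m) => //; exact: MM.
  by rewrite dvdn_leq // gcdn_gt0 N1_gt0.
by rewrite dvdn_gcd dvdn_gcdr (dvdn_trans (dvdn_gcdl _ _)) // dvdn_mull.
Qed.

Lemma continuous_opens (S T : choiceType) (tau : topology S)
    (sigma : topology T) (f : S -> T) :
  continuous (f : topspace tau -> topspace sigma) <->
  forall U, opens sigma U -> opens tau (f @^-1` U).
Proof.
split=> [/continuousP fc U|fc].
  by have := fc U; rewrite !topspace_openE.
by apply/continuousP => U; rewrite !topspace_openE; exact: fc.
Qed.

Section QuotientTopology.
Variables (S T : choiceType) (tau : topology S) (f : S -> T).

Let quot : set_system T := [set U | opens tau (f @^-1` U)].

Let quotT : quot setT. Proof. by rewrite /quot /= preimage_setT; exact: opensT. Qed.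

Let quotI : setI_closed quot.
Proof. by move=> A B; rewrite /quot /= preimage_setI; exact: opensI. Qed.

Let quot_bigU (I : Type) (F : I -> set T) :
  (forall i, quot (F i)) -> quot (\bigcup_i F i).
Proof. by move=> qF; rewrite /quot /= preimage_bigcup; exact: opens_bigU. Qed.

Definition quotient_top : topology T := Topology quotT quotI quot_bigU.

End QuotientTopology.

(** The quotient topologies of [tau] contain those of [fam] and keep all reductions continuous, so
    they induce [tau] too; maximality then makes [fam] at least as fine. *)
Lemma maximal_family_opens (tau : topology int) (fam : topfamily) (n : N1)
    (U : set (Zmod n)) :
  maximal_family_of tau fam ->
  opens (fam n) U <-> opens tau (Zred n @^-1` U).
Proof.
move=> [ind maxf]; have [contf coarse] := ind; split.
  exact: (proj1 (continuous_opens _ _ _ _ _) (contf n) U).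
apply: (maxf (fun k => quotient_top _ _ tau (Zred k))).
exists tau; split=> //; split=> [k|tau' cont']; first exact/continuous_opens.
apply: coarse => k; apply/continuous_opens => V oV.
apply: (proj1 (continuous_opens _ _ _ _ _) (cont' k)).
exact: (proj1 (continuous_opens _ _ _ _ _) (contf k)).
Qed.

(* The topology with base the [tau]-open sets periodic modulo some element of
   [M].  By the coarseness of [tau], comparing the two shows that these sets
   are a base of [tau]. *)
Section PeriodicTopology.
Variables (tau : topology int) (M : set N1).
Hypothesis Mmon : submonoid M.

Let per : set_system int := [set U | forall a, U a ->
  exists2 m, M m & exists A, [/\ opens tau A, periodic m A, A a & A `<=` U]].

Let perT : per setT.
Proof.
move=> a _; exists one_N1; first by case: Mmon.
by exists setT; split=> //; exact: opensT.
Qed.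

Let perI : setI_closed per.
Proof.
move=> U V pU pV a [/pU [m Mm [A [oA pA Aa AU]]] /pV [n Mn [B [oB pB Ba BV]]]].
exists (mul_N1 m n); first by case: Mmon => _; apply.
exists (A `&` B); split=> //; first exact: opensI; last exact: setISS.
move=> c d cd [Ac Bc]; split.
  by apply: pA Ac; apply: Zred_dvd cd; exact: dvdn_mulr.
by apply: pB Bc; apply: Zred_dvd cd; exact: dvdn_mull.
Qed.

Let per_bigU (I : Type) (F : I -> set int) :
  (forall i, per (F i)) -> per (\bigcup_i F i).
Proof.
move=> pF a [i _ Fia]; have [m Mm [A [oA pA Aa AF]]] := pF i a Fia.
by exists m => //; exists A; split=> //; apply: subset_trans AF _; exact: bigcup_sup.
Qed.

Definition periodic_topology : topology int := Topology perT perI per_bigU.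

End PeriodicTopology.

Lemma determining_monoid_periodic (tau : topology int) (fam : topfamily)
    (M : set N1) (W : set int) (a : int) :
  maximal_family_of tau fam -> determining_monoid tau M ->
  opens tau W -> W a ->
  exists2 m, M m & exists A, [/\ opens tau A, periodic m A, A a & A `<=` W].
Proof.
move=> fam_max [Mmon Mdet] oW.
have [tau0 [[cont0 _] [_ coarse0]]] := Mdet _ fam_max.
have [[contf coarse] _] := fam_max.
suff : opens (periodic_topology tau M Mmon) W by apply.
(* [tau] is coarser than [tau0], and [tau0] is coarser than any topology making the reductions
   continuous for the restricted family. *)
apply: (coarse0 _ _ W (coarse _ cont0 W oW)) => n.
apply/continuous_opens => U; rewrite /restrict_family.
case: asboolP => [Mn oU|_ [->|->]]; last 2 first.
- by rewrite preimage_set0 => /= b [].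
- by rewrite preimage_setT; exact: opensT.
move=> /= b Ub; exists n => //; exists (Zred n @^-1` U); split=> //.
  exact/(maximal_family_opens _ _ _ _ fam_max).
by move=> c d cd; rewrite /preimage /= cd.
Qed.

Lemma prod_indiscrete_point (I : Type) (T : I -> topologicalType)
    (x : prod_topology T) :
  (forall i, indiscrete_point (T i) (x i)) ->
  indiscrete_point (prod_topology T) x.
Proof.
move=> ix U oU Ux; apply/seteqP; split=> // y _.
(* Stated as convergence, the claim can be checked on each initial topology whose supremum is the
   product topology. *)
suff cvyx : principal_filter y --> x.
  by apply: (cvyx U) => //; exact: (@open_nbhs_nbhs (prod_topology T)).
apply/(@cvg_sup _ _ (fun i =>
  Topological.class (initial_topology (@proj I T i)))) => i A [_ [[B oB <-] Bx BA]].
by apply/principal_filterP/BA; rewrite /preimage /= (ix i B oB Bx).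
Qed.

Lemma set_type_indiscrete_point (T : topologicalType) (X : set T)
    (x : set_type X) :
  indiscrete_point T (set_val x) -> indiscrete_point (set_type X) x.
Proof.
move=> ix U oU Ux; apply/seteqP; split=> // y _.
have [_ [[B oB <-] Bx BU]] : nbhs x U by apply: open_nbhs_nbhs; split.
by apply: BU; rewrite /preimage /= (ix B oB Bx).
Qed.

(** If [U] were proper, its complement would be a nonempty closed set, hence would contain [x]. *)
Lemma closed_core_indiscrete (fam : topfamily) (n : N1) (x : Zmod n)
    (U : set (Zmod n)) :
  closed_core fam n x -> opens (fam n) U -> U x -> U = setT.
Proof.
move=> xB oU Ux; apply/seteqP; split=> // y _.
apply: contrapT => nUy; suff : (~` U) x by [].
apply: (xB (~` U)); split; last by exists y.
by apply: (@open_closedC (topspace (fam n))); rewrite topspace_openE.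
Qed.

Theorem proposition3p19 (tau : topology int) (fam : topfamily) (M : set N1)
  (tau_peiji : peiji tau)
  (fam_max : maximal_family_of tau fam)
  (M_det : determining_monoid tau M)
  (proj_core : forall m n : N1, M m -> M n -> (n %| m)%N ->
     Zproj m n @` closed_core fam m = closed_core fam n) :
  let B : set (Zhat fam) :=
    \bigcap_(n in M) (hatpi fam n @^-1` closed_core fam n) in
  forall x : Zhat fam, B x -> indiscrete_point (Zhat fam) x.
Proof.
move=> B x Bx; apply: set_type_indiscrete_point; apply: prod_indiscrete_point.
move=> n U; rewrite topspace_openE => oU.
rewrite -[set_val x n]/(hatpi fam n x) => Ux.
have [s Ms maxs] := exists_max_gcd M n (proj1 M_det).
set W := Zred n @^-1` U.
have oW : opens tau W by apply/(maximal_family_opens _ _ _ _ fam_max).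
have perW : periodic s W.
  move=> a b /Zred_eq ab Wa.
  have [m Mm [A [_ pA Aa AW]]] :=
    determining_monoid_periodic _ _ _ _ _ fam_max M_det oW Wa.
  (* Such a [c] links [a] to [b]: [A] is [m]-periodic, which puts [c] in [W], and [W] is
     [n]-periodic. *)
  have [c [cm cn]] : exists c, Zred m c = Zred m a /\ Zred n c = Zred n b.
    apply: chinese_gcd; apply: dvdz_trans ab; rewrite dvdzE /=.
    exact: dvdn_trans (maxs m Mm) (dvdn_gcdl _ _).
  by have := AW c (pA _ _ (esym cm) Aa); rewrite /W /preimage /= cn.
have WE : Zred s @^-1` (Zred s @` W) = W.
  apply/seteqP; split=> [a [b Wb ba]|a Wa]; first exact: perW ba Wb.
  by exists a.
have oV : opens (fam s) (Zred s @` W).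
  by apply/(maximal_family_opens _ _ _ _ fam_max); rewrite WE.
(* Working modulo [n * s] yields one integer that represents [x] modulo [n] and modulo [s] at
   once. *)
have [k kx] := Zred_surj _ (hatpi fam (mul_N1 n s) x).
have kE (d : N1) : (d %| mul_N1 n s)%N -> Zred d k = hatpi fam d x.
  move=> dns; rewrite -(Zproj_red _ dns) kx.
  by have := set_valP x; apply.
have Vx : (Zred s @` W) (hatpi fam s x).
  exists k; last by apply: kE; exact: dvdn_mull.
  by rewrite -[W k]/(U (Zred n k)) kE //; exact: dvdn_mulr.
have VT := closed_core_indiscrete _ _ _ _ (Bx s Ms) oV Vx.
apply/seteqP; split=> // y _; have [a <-] := Zred_surj _ y.
by rewrite -[U _]/(W a) -WE VT.
Qed.
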